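(* Let $\alpha\in\mathbb R\setminus\{0\}$. For $\varepsilon\in\mathbb R\setminus\{0\}$ define $T_\varepsilon:L^2(\mu)\to L^2(\mu_\alpha)$ by $$T_\varepsilon f(s)=\int_{\mathbb R}\frac{f(t)}{s-t+i\varepsilon}\,d\mu(t).$$ Then the operators $T_\varepsilon$ are bounded uniformly in $\varepsilon$: $\sup_{\varepsilon\ne0}\|T_\varepsilon\|_{L^2(\mu)\to L^2(\mu_\alpha)}<\infty$.
   Context: Let $\mu$ be a nonzero positive Borel measure on $\mathbb R$ with $\int_{\mathbb R}(1+|t|)^{-1}\,d\mu(t)<\infty$, and $F(\lambda)=\int_{\mathbb R}\frac{d\mu(t)}{t-\lambda}$ for $\lambda\in\mathbb C\setminus\mathbb R$. For $\alpha\in\mathbb R$, $\mu_\alpha$ denotes the unique positive Borel measure on $\mathbb R$ with $\int_{\mathbb R}\frac{d\mu_\alpha(s)}{s-\lambda}=\frac{F(\lambda)}{1+\alpha F(\lambda)}$ for all $\lambda\notin\mathbb R$; it is the spectral measure, with respect to $\mathbf 1$, of the rank one perturbation $A_\alpha=M_t+\alpha(\,\cdot\,,\mathbf 1)\mathbf 1$ of multiplication by $t$ on $L^2(\mu)$. *)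

(* Defs.v *)
From HB Require Import structures.
From mathcomp Require Import all_boot all_order all_algebra.
From mathcomp Require Import all_classical all_reals all_analysis.
From mathcomp Require Import complex.
Set Implicit Arguments. Unset Strict Implicit. Unset Printing Implicit Defensive.
Import Order.TTheory GRing.Theory Num.Theory.
Local Open Scope ring_scope.
Local Open Scope classical_set_scope.

Section Defs.
Variable R : realType.

Definition cabs2 (z : R[i]) : R := (complex.Re z) ^+ 2 + (complex.Im z) ^+ 2.

Definition cmeasurable (f : R -> R[i]) : Prop :=
  measurable_fun setT (fun x => complex.Re (f x)) /\
  measurable_fun setT (fun x => complex.Im (f x)).

Definition cintegrable (mu : {measure set R -> \bar R}) (f : R -> R[i]) : Prop :=
  mu.-integrable setT (fun x => (complex.Re (f x))%:E) /\
  mu.-integrable setT (fun x => (complex.Im (f x))%:E).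

Definition cintegral (mu : {measure set R -> \bar R}) (f : R -> R[i]) : R[i] :=
  ((Rintegral mu setT (fun x => complex.Re (f x))) +i*
  (Rintegral mu setT (fun x => complex.Im (f x))))%C.

Definition L2 (mu : {measure set R -> \bar R}) (f : R -> R[i]) : Prop :=
  cmeasurable f /\ (\int[mu]_x (cabs2 (f x))%:E < +oo)%E.

Definition L2norm2 (mu : {measure set R -> \bar R}) (f : R -> R[i]) : \bar R :=
  (\int[mu]_x (cabs2 (f x))%:E)%E.

Definition borel_transform (mu : {measure set R -> \bar R}) (lam : R[i]) : R[i] :=
  cintegral mu (fun t => (t%:C%C - lam)^-1).

Definition is_mu_alpha (mu : {measure set R -> \bar R}) (alpha : R)
    (mua : {measure set R -> \bar R}) : Prop :=
  forall lam : R[i], complex.Im lam != 0 ->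
    cintegrable mua (fun s => (s%:C%C - lam)^-1) /\
    borel_transform mua lam =
      borel_transform mu lam / (1 + alpha%:C%C * borel_transform mu lam).

Definition T_eps (mu : {measure set R -> \bar R}) (eps : R) (f : R -> R[i]) (s : R) : R[i] :=
  cintegral mu (fun t => f t / (s%:C%C - t%:C%C + 'i * eps%:C%C)).

End Defs.

(* Main.v *)
Require Import Defs.
From HB Require Import structures.
From mathcomp Require Import all_boot all_order all_algebra.
From mathcomp Require Import all_classical all_reals all_analysis.
From mathcomp Require Import complex.
From mathcomp Require Import measurable_realfun ring lra.
Import Order.TTheory GRing.Theory Num.Theory.
Import numFieldNormedType.Exports.
Local Open Scope ring_scope.
Local Open Scope classical_set_scope.
Set Implicit Arguments. Unset Strict Implicit. Unset Printing Implicit Defensive.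

(* Proof idea. Let F be the Borel transform of mu. The map V sending 1/(t - l) to
   (1 + alpha F(l))/(s - l) preserves inner products of Cauchy kernels, since
   <1/(t - l), 1/(t - l')> is a divided difference of F and F_alpha = F/(1 + alpha F).
   On simple fractions, X := alpha T_eps - V solves (s + i eps) X f - X (t f) = -i eps V f.
   Put y := i rho eps with rho >= 2, u(s) := (s + i eps - y)/(s + y),
   v(t) := (t + y - i eps)/(t - y) and m := (2 rho - 1) eps^2. A Cayley transform turns
   this equation into X f = u X(v f) - m/(s + y) V(f/(t - y)), where
   |u|^2 + m/|s + y|^2 = 1 and |v|^2 + m/|t - y|^2 = 1. Iterating with different poles y,
   the energies m |V(f/(t - y))|^2 telescope to at most |f|^2, while
   the product of the factors v tends to 0 pointwise. Simple fractions need not be known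
   to be dense: T_eps f(s) is a pairing of f with a Cauchy kernel, so f may be replaced by
   an almost optimal approximation by kernels with poles on the line Im = -eps, the
   remainder being almost orthogonal to these kernels. *)

(** * Complex-valued integrals *)

Section ComplexAbs.
Variable R : realType.
Implicit Types z w : R[i].
Local Notation Re := complex.Re.
Local Notation Im := complex.Im.

Lemma cReM z w : Re (z * w) = Re z * Re w - Im z * Im w.
Proof. by case: z w => [a b] [c d]. Qed.

Lemma cImM z w : Im (z * w) = Re z * Im w + Im z * Re w.
Proof. by case: z w => [a b] [c d]. Qed.

Lemma cReD z w : Re (z + w) = Re z + Re w.
Proof. by case: z w => [a b] [c d]. Qed.

Lemma cImD z w : Im (z + w) = Im z + Im w.
Proof. by case: z w => [a b] [c d]. Qed.

Lemma cReN z : Re (- z) = - Re z. Proof. by case: z. Qed.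

Lemma cImN z : Im (- z) = - Im z. Proof. by case: z. Qed.

Lemma cReJ z : Re (z^*)%C = Re z. Proof. by case: z. Qed.

Lemma cImJ z : Im (z^*)%C = - Im z. Proof. by case: z. Qed.

Lemma cabs2E z : (cabs2 z)%:C%C = z * (z^*)%C.
Proof.
case: z => a b; apply/eqP; rewrite eq_complex /cabs2 /=.
by apply/andP; split; apply/eqP; ring.
Qed.

Lemma cabs2_ge0 z : 0 <= cabs2 z.
Proof. by rewrite addr_ge0 // sqr_ge0. Qed.

Lemma cabs2_eq0 z : (cabs2 z == 0) = (z == 0).
Proof.
by rewrite paddr_eq0 ?sqr_ge0 // !sqrf_eq0 eq_complex.
Qed.

Lemma cabs2M z w : cabs2 (z * w) = cabs2 z * cabs2 w.
Proof. by rewrite /cabs2 cReM cImM; ring. Qed.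

Lemma cabs2N z : cabs2 (- z) = cabs2 z.
Proof. by rewrite /cabs2 cReN cImN !sqrrN. Qed.

Lemma cabs2J z : cabs2 (z^*)%C = cabs2 z.
Proof. by case: z => a b; rewrite /cabs2 /= sqrrN. Qed.

Lemma cabs2_real (r : R) : cabs2 (r%:C%C) = r ^+ 2.
Proof. by rewrite /cabs2 /= expr0n addr0. Qed.

Lemma cabs2V z : cabs2 z^-1 = (cabs2 z)^-1.
Proof.
have [->|z0] := eqVneq z 0; first by rewrite invr0 /cabs2 /= expr0n addr0 invr0.
have c0 : cabs2 z != 0 by rewrite cabs2_eq0.
apply: (mulfI c0); rewrite -cabs2M !divff //.
by rewrite /cabs2 /= expr1n expr0n addr0.
Qed.

Lemma cabs2D_le z w : cabs2 (z + w) <= 2 * (cabs2 z + cabs2 w).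
Proof.
rewrite -subr_ge0 (_ : _ - _ = cabs2 (z - w)) ?cabs2_ge0 //.
by rewrite /cabs2 !cReD !cImD cReN cImN; ring.
Qed.

Lemma inv_conj z : z^-1 = ((cabs2 z)^-1)%:C%C * (z^*)%C.
Proof.
have [->|z0] := eqVneq z 0; first by rewrite invr0 conjc0 mulr0.
have c0 : (cabs2 z)%:C%C != 0 by rewrite fmorph_eq0 cabs2_eq0.
apply: (mulfI c0); rewrite mulrA -rmorphM divff ?cabs2_eq0 // mul1r.
by rewrite cabs2E mulrAC mulfV ?mul1r.
Qed.

(** Cauchy-Schwarz for the vectors [(u, r / sqrt m)], a unit vector by hypothesis, and
    [(a, - sqrt m * b)]; [m] times the difference of the two sides is an explicit square. *)
Lemma cabs2_convex_le (u r a b : R[i]) (m : R) : 0 < m ->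
  cabs2 u + cabs2 r / m = 1 ->
  cabs2 (u * a - r * b) <= cabs2 a + m * cabs2 b.
Proof.
move=> m0 e.
have mE : m = m * cabs2 u + cabs2 r by rewrite -[LHS]mulr1 -e; field; rewrite gt_eqF.
rewrite -subr_ge0 -(pmulr_rge0 _ m0).
suff -> : m * (cabs2 a + m * cabs2 b - cabs2 (u * a - r * b)) =
    cabs2 (m%:C%C * ((u^*)%C * b) + (r^*)%C * a) by exact: cabs2_ge0.
have -> : m * (cabs2 a + m * cabs2 b - cabs2 (u * a - r * b)) =
    (m * cabs2 u + cabs2 r) * (cabs2 a + m * cabs2 b) - m * cabs2 (u * a - r * b).
  by rewrite -mE mulrBr.
case: u r a b {e mE} => [u1 u2] [r1 r2] [a1 a2] [b1 b2].
by rewrite /cabs2 /=; ring.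
Qed.

End ComplexAbs.

Section ComplexIntegral.
Variables (R : realType) (mu : {measure set R -> \bar R}).
Implicit Types f g : R -> R[i].
Local Notation Re := complex.Re.
Local Notation Im := complex.Im.

Lemma EFin_integrableZ (a : R) (h : R -> R) : mu.-integrable setT (EFin \o h) ->
  mu.-integrable setT (EFin \o (fun t => a * h t)).
Proof.
by move=> ih; apply: (eq_integrable _ (fun t => (a%:E * (h t)%:E)%E)) => //; exact: integrableZl.
Qed.

Lemma EFin_integrableD (h k : R -> R) : mu.-integrable setT (EFin \o h) ->
  mu.-integrable setT (EFin \o k) -> mu.-integrable setT (EFin \o (fun t => h t + k t)).
Proof.
move=> ih ik; apply: (eq_integrable _ (fun t => ((h t)%:E + (k t)%:E)%E)) => //.
exact: integrableD.
Qed.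

Lemma cintegrable_measurable f : cintegrable mu f -> cmeasurable f.
Proof.
by case=> h1 h2; split; apply/measurable_EFinP; [exact: measurable_int h1|exact: measurable_int h2].
Qed.

Lemma eq_cintegral f g : f =1 g -> cintegral mu f = cintegral mu g.
Proof. by move=> /funext ->. Qed.

Lemma cintegrableD f g : cintegrable mu f -> cintegrable mu g ->
  cintegrable mu (fun x => f x + g x).
Proof.
move=> [f1 f2] [g1 g2]; split.
  under eq_fun do rewrite cReD EFinD; exact: integrableD.
by under eq_fun do rewrite cImD EFinD; exact: integrableD.
Qed.

Lemma cintegralD f g : cintegrable mu f -> cintegrable mu g ->
  cintegral mu (fun x => f x + g x) = cintegral mu f + cintegral mu g.
Proof.
move=> [f1 f2] [g1 g2]; rewrite /cintegral.
rewrite (_ : (fun x => Re (f x + g x)) = (fun x => Re (f x) + Re (g x))); last first.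
  by apply/funext => x; rewrite cReD.
rewrite (_ : (fun x => Im (f x + g x)) = (fun x => Im (f x) + Im (g x))); last first.
  by apply/funext => x; rewrite cImD.
by rewrite !RintegralD.
Qed.

Lemma cintegrableZ (c : R[i]) f : cintegrable mu f ->
  cintegrable mu (fun x => c * f x).
Proof.
move=> [f1 f2]; split.
  under eq_fun do rewrite cReM EFinB !EFinM.
  by apply: integrableB => //; exact: integrableZl.
under eq_fun do rewrite cImM EFinD !EFinM.
by apply: integrableD => //; exact: integrableZl.
Qed.

Lemma cintegralZ (c : R[i]) f : cintegrable mu f ->
  cintegral mu (fun x => c * f x) = c * cintegral mu f.
Proof.
move=> [f1 f2]; rewrite /cintegral.
rewrite (_ : (fun x => Re (c * f x)) = (fun x => Re c * Re (f x) - Im c * Im (f x))); last first.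
  by apply/funext => x; rewrite cReM.
rewrite (_ : (fun x => Im (c * f x)) = (fun x => Re c * Im (f x) + Im c * Re (f x))); last first.
  by apply/funext => x; rewrite cImM.
have i1 (a : R) : mu.-integrable setT (fun x => (a * Re (f x))%:E).
  exact: EFin_integrableZ.
have i2 (a : R) : mu.-integrable setT (fun x => (a * Im (f x))%:E).
  exact: EFin_integrableZ.
have -> : \int[mu]_x (Re c * Re (f x) - Im c * Im (f x))%R =
    Re c * \int[mu]_x (Re (f x)) - Im c * \int[mu]_x (Im (f x)).
  rewrite RintegralB //; [by rewrite !RintegralZl|exact: i1|exact: i2].
have -> : \int[mu]_x (Re c * Im (f x) + Im c * Re (f x))%R =
    Re c * \int[mu]_x (Im (f x)) + Im c * \int[mu]_x (Re (f x)).
  rewrite RintegralD //; [by rewrite !RintegralZl|exact: i2|exact: i1].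
by case: c {i1 i2}.
Qed.

Lemma cintegrable0 : cintegrable mu (fun=> 0).
Proof. by split; exact: integrable0. Qed.

Lemma cintegral0 : cintegral mu (fun=> 0) = 0.
Proof. by rewrite /cintegral /Rintegral !integral0. Qed.

Lemma cintegrable_sum (I : eqType) (s : seq I) (F : I -> R -> R[i]) :
  {in s, forall i, cintegrable mu (F i)} ->
  cintegrable mu (fun x => \sum_(i <- s) F i x).
Proof.
elim: s => [|a s ih] h.
  by under eq_fun do rewrite big_nil; exact: cintegrable0.
under eq_fun do rewrite big_cons.
apply: cintegrableD; first exact/h/mem_head.
by apply: ih => i si; apply: h; rewrite inE si orbT.
Qed.

Lemma cintegral_sum (I : eqType) (s : seq I) (F : I -> R -> R[i]) :
  {in s, forall i, cintegrable mu (F i)} ->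
  cintegral mu (fun x => \sum_(i <- s) F i x) = \sum_(i <- s) cintegral mu (F i).
Proof.
elim: s => [|a s ih] h.
  by under eq_fun do rewrite big_nil; rewrite cintegral0 big_nil.
have hs : {in s, forall i, cintegrable mu (F i)}.
  by move=> i si; apply: h; rewrite inE si orbT.
under eq_fun do rewrite big_cons.
rewrite big_cons cintegralD ?ih //; first exact/h/mem_head.
exact: cintegrable_sum.
Qed.

Lemma cintegralJ f : cintegrable mu f ->
  cintegral mu (fun x => (f x)^*%C) = ((cintegral mu f)^*)%C.
Proof.
move=> [f1 f2]; rewrite /cintegral.
have -> : (fun x => Re ((f x)^*)%C) = (fun x => Re (f x)).
  by apply/funext => x; rewrite cReJ.
have -> : (fun x => Im ((f x)^*)%C) = (fun x => -1 * Im (f x)).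
  by apply/funext => x; rewrite mulN1r cImJ.
by rewrite RintegralZl // mulN1r.
Qed.

Lemma cintegral_real (f : R -> R) :
  cintegral mu (fun x => (f x)%:C%C) = (Rintegral mu setT f)%:C%C.
Proof.
by rewrite /cintegral /= /Rintegral integral0.
Qed.

Lemma cmeasurableM f g : cmeasurable f -> cmeasurable g ->
  cmeasurable (fun x => f x * g x).
Proof.
move=> [f1 f2] [g1 g2]; split.
  under eq_fun do rewrite cReM.
  by apply: measurable_funB; exact: measurable_funM.
under eq_fun do rewrite cImM.
by apply: measurable_funD; exact: measurable_funM.
Qed.

Lemma cmeasurableD f g : cmeasurable f -> cmeasurable g ->
  cmeasurable (fun x => f x + g x).
Proof.
move=> [f1 f2] [g1 g2]; split.
  by under eq_fun do rewrite cReD; exact: measurable_funD.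
by under eq_fun do rewrite cImD; exact: measurable_funD.
Qed.

Lemma cmeasurable_cst c : cmeasurable (fun=> c : R[i]).
Proof. by split; exact: measurable_cst. Qed.

Lemma cmeasurableJ f : cmeasurable f -> cmeasurable (fun x => (f x)^*%C).
Proof.
move=> [f1 f2]; split; first by under eq_fun do rewrite cReJ.
under eq_fun do rewrite cImJ.
exact: measurable_funN.
Qed.

Lemma measurable_cabs2 f : cmeasurable f -> measurable_fun setT (fun x => cabs2 (f x)).
Proof.
by move=> [f1 f2]; apply: measurable_funD; exact: measurable_funX.
Qed.

Lemma L2_integrable f : L2 mu f <->
  cmeasurable f /\ mu.-integrable setT (fun x => (cabs2 (f x))%:E).
Proof.
split=> -[mf h]; split => //.
  apply/integrableP; split; first by apply/measurable_EFinP; exact: measurable_cabs2.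
  rewrite (le_lt_trans _ h) // le_eqVlt; apply/orP; left; apply/eqP.
  by apply: eq_integral => x _ /=; rewrite ger0_norm // cabs2_ge0.
case/integrableP : h => _; apply: le_lt_trans.
rewrite le_eqVlt; apply/orP; left; apply/eqP.
by apply: eq_integral => x _ /=; rewrite ger0_norm // cabs2_ge0.
Qed.

Lemma L2norm2E f : L2 mu f ->
  L2norm2 mu f = (Rintegral mu setT (fun x => cabs2 (f x)))%:E.
Proof. by move=> /L2_integrable[_ h]; rewrite /Rintegral fineK // integrable_fin_num. Qed.

Lemma L2D f g : L2 mu f -> L2 mu g -> L2 mu (fun x => f x + g x).
Proof.
move=> /L2_integrable[mf hf] /L2_integrable[mg hg].
apply/L2_integrable; have mD := cmeasurableD mf mg; split => //.
have i2 := EFin_integrableZ 2 (EFin_integrableD hf hg).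
apply: (le_integrable _ _ _ i2) => //.
- by apply/measurable_EFinP; exact: measurable_cabs2.
- move=> x _ /=; rewrite lee_fin !ger0_norm ?cabs2_ge0 ?cabs2D_le //.
  by rewrite mulr_ge0 // addr_ge0 // cabs2_ge0.
Qed.

Lemma L2Z c f : L2 mu f -> L2 mu (fun x => c * f x).
Proof.
move=> /L2_integrable[mf hf]; apply/L2_integrable; split.
  by apply: cmeasurableM => //; exact: cmeasurable_cst.
by under eq_fun do rewrite cabs2M EFinM; exact: integrableZl.
Qed.

Lemma L2_0 : L2 mu (fun=> 0).
Proof.
apply/L2_integrable; split; first exact: cmeasurable_cst.
under eq_fun do rewrite /cabs2 /= expr0n addr0; exact: integrable0.
Qed.

Lemma L2_sum (I : eqType) (s : seq I) (F : I -> R -> R[i]) :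
  {in s, forall i, L2 mu (F i)} -> L2 mu (fun x => \sum_(i <- s) F i x).
Proof.
elim: s => [|a s ih] h.
  by under eq_fun do rewrite big_nil; exact: L2_0.
under eq_fun do rewrite big_cons.
apply: L2D; first exact/h/mem_head.
by apply: ih => i si; apply: h; rewrite inE si orbT.
Qed.

Lemma L2J f : L2 mu f -> L2 mu (fun x => (f x)^*%C).
Proof.
move=> [mf hf]; split; first exact: cmeasurableJ.
by under eq_integral do rewrite cabs2J.
Qed.

(** Both parts of [f x * g x] have the shape [a * c - b * d], which the inequality between products
    and squares bounds by [cabs2 (f x) + cabs2 (g x)]. *)
Lemma L2M_cintegrable f g : L2 mu f -> L2 mu g -> cintegrable mu (fun x => f x * g x).
Proof.
move=> /L2_integrable[mf hf] /L2_integrable[mg hg].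
have [m1 m2] := cmeasurableM mf mg.
have iD := EFin_integrableD hf hg.
have B (a b c d : R) : `|a * c - b * d| <= `|a ^+ 2 + b ^+ 2 + (c ^+ 2 + d ^+ 2)|.
  have h1 := sqr_ge0 (a + c); have h2 := sqr_ge0 (b - d).
  have h3 := sqr_ge0 (a - c); have h4 := sqr_ge0 (b + d).
  rewrite [leRHS]ger0_norm ?addr_ge0 ?sqr_ge0 // ler_norml.
  by apply/andP; split; nra.
split; apply: (le_integrable _ _ _ iD) => //; try exact/measurable_EFinP.
  move=> x _; rewrite lee_fin cReM /cabs2; exact: B.
move=> x _; rewrite lee_fin cImM /cabs2.
move: (B (Re (f x)) (- Im (f x)) (Im (g x)) (Re (g x))).
by rewrite mulNr opprK sqrrN [Im (g x) ^+ 2 + _]addrC.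
Qed.

End ComplexIntegral.

(** * Cauchy kernels *)

Section CauchyKernel.
Variable R : realType.
Implicit Types (t : R) (l : R[i]) (mu : {measure set R -> \bar R}).
Local Notation Re := complex.Re.
Local Notation Im := complex.Im.

(** This is the common hypothesis for both measures: for [mu] it follows from the finite weighted
    integral, for [mua] it is part of [is_mu_alpha]. *)
Definition kernel_integrable mu :=
  forall l, Im l != 0 -> cintegrable mu (fun t => (t%:C%C - l)^-1).

Lemma neq_Im (z w : R[i]) : Im z != Im w -> z - w != 0.
Proof. by apply: contra_neqN; rewrite subr_eq0 => /eqP ->. Qed.

Lemma real_neq t l : Im l != 0 -> t%:C%C - l != 0.
Proof. by move=> l0; apply: neq_Im; rewrite eq_sym. Qed.

Lemma cauchyJ t l : (((t%:C%C - l)^-1)^*)%C = (t%:C%C - (l^*)%C)^-1.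
Proof.
rewrite conjc_inv; congr (_^-1); case: l => a b.
by apply/eqP; rewrite eq_complex /= opprD !opprK oppr0 !eqxx.
Qed.

Lemma cauchy_inv t l : (t%:C%C - l)^-1 =
  ((t - Re l) / cabs2 (t%:C%C - l) +i* (Im l / cabs2 (t%:C%C - l)))%C.
Proof.
rewrite inv_conj; move: (cabs2 _)^-1 => c.
case: l => a b; apply/eqP; rewrite eq_complex /=; apply/andP; split; apply/eqP; ring.
Qed.

Lemma cauchy_le (x b M : R) : 0 <= x -> 0 < b -> 0 <= M ->
  x * (M + x) <= (1 + M / b) * (x ^+ 2 + b ^+ 2).
Proof.
move=> x0 b0 M0; have c0 : 0 <= M / b by rewrite divr_ge0 // ltW.
have -> : M = M / b * b by rewrite divfK // gt_eqF.
rewrite mulfK ?gt_eqF //; move: (M / b) c0 => c c0.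
have h : 0 <= c * ((x - b) ^+ 2 + x ^+ 2 + b ^+ 2).
  by rewrite mulr_ge0 // !addr_ge0 // sqr_ge0.
have := sqr_ge0 b; nra.
Qed.

Lemma measurable_fun_continuousV (g : R -> R) : continuous g ->
  (forall t, g t != 0) -> measurable_fun setT (fun t => (g t)^-1).
Proof.
move=> cg g0; apply: continuous_measurable_fun => t.
by apply: continuousV; [exact: g0|exact: cg].
Qed.

Lemma kernel_integrable_of_finite mu :
  (\int[mu]_t ((1 + `|t|)^-1)%:E < +oo)%E -> kernel_integrable mu.
Proof.
move=> fin l l0.
have den t : 0 < (t - Re l) ^+ 2 + Im l ^+ 2.
  by rewrite ltr_wpDl ?sqr_ge0 // exprn_even_gt0.
have denE t : cabs2 (t%:C%C - l) = (t - Re l) ^+ 2 + Im l ^+ 2.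
  by rewrite /cabs2 cReD cImD cReN cImN /= add0r sqrrN.
(* The constant of [cauchy_le] with [M = 1 + |Re l|] and [b = |Im l|], where
   [1 + |t| <= M + |t - Re l|]. *)
pose K := 1 + (1 + `|Re l|) / `|Im l|.
have K0 : 0 <= K by rewrite addr_ge0 // divr_ge0 // addr_ge0.
have b0 : 0 < `|Im l| by rewrite normr_gt0.

have mg : mu.-integrable setT (fun t => (K * (1 + `|t|)^-1)%:E).
  under eq_fun do rewrite EFinM; apply: integrableZl => //.
  apply/integrableP; split.
    apply/measurable_EFinP; apply: measurable_fun_continuousV => [t|t].
      by apply: continuousD; [exact: cst_continuous|exact: norm_continuous].
    by rewrite gt_eqF // ltr_pwDl.
  rewrite (le_lt_trans _ fin) // le_eqVlt; apply/orP; left; apply/eqP.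
  by apply: eq_integral => t _ /=; rewrite ger0_norm // invr_ge0 addr_ge0.
have mden : measurable_fun setT (fun t => (cabs2 (t%:C%C - l))^-1).
  under eq_fun do rewrite denE.
  apply: measurable_fun_continuousV => [t|t]; last by rewrite gt_eqF.
  apply: cvgD; last exact: cvg_cst.
  by apply: (@cvgM _ _ _ _ (fun x => x - Re l) (fun x => x - Re l));
    apply: cvgB; [exact: cvg_id|exact: cvg_cst|exact: cvg_id|exact: cvg_cst].
(* The absolute values of the two parts of the kernel are [x / cabs2 (t - l)] with [x = |t - Re l|]
   or [x = |Im l|], so one estimate serves both. *)
have bound (x t : R) : x <= `|t - Re l| \/ x <= `|Im l| -> 0 <= x ->
    x / cabs2 (t%:C%C - l) <= K * (1 + `|t|)^-1.
  move=> hx x0; rewrite denE ler_pdivrMr // mulrAC ler_pdivlMr ?ltr_pwDl //.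
  have t1 : 1 + `|t| <= (1 + `|Re l|) + `|t - Re l|.
    by rewrite -addrA lerD2l -[in leLHS](subrK (Re l) t) addrC ler_normD.
  apply: (@le_trans _ _ (x * ((1 + `|Re l|) + `|t - Re l|))).
    by rewrite ler_wpM2l.
  rewrite -(real_normK (num_real (t - _))) -(real_normK (num_real (Im l))) /K.
  have M0 : 0 <= 1 + `|Re l| by rewrite addr_ge0.
  move: (1 + `|Re l|) (`|t - Re l|) (`|Im l|) hx b0 M0 (normr_ge0 (t - Re l)).
  move=> M y b hx b0 M0 y0; case: hx => hx.
    apply: le_trans (cauchy_le y0 b0 M0).
    by rewrite ler_wpM2r // addr_ge0.
  apply: (@le_trans _ _ (b * (M + y))); first by rewrite ler_wpM2r // addr_ge0.
  have c0 : 0 <= M / b by rewrite divr_ge0 // ltW.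
  have -> : b * (M + y) = M / b * b ^+ 2 + b * y by field; rewrite gt_eqF.
  have := mulr_ge0 c0 (sqr_ge0 y); have := sqr_ge0 (b - y); have := sqr_ge0 (b + y); nra.
split.
  apply: (le_integrable _ _ _ mg) => //.
    under eq_fun do rewrite cauchy_inv /=; apply/measurable_EFinP.
    by apply: measurable_funM => //; apply: measurable_funB => //.
  move=> t _; rewrite lee_fin [leRHS]ger0_norm ?mulr_ge0 ?invr_ge0 ?addr_ge0 //.
  rewrite cauchy_inv /= normrM normfV (ger0_norm (cabs2_ge0 _)).
  by apply: bound => //; left.
apply: (le_integrable _ _ _ mg) => //.
  under eq_fun do rewrite cauchy_inv /=; apply/measurable_EFinP.
  by apply: measurable_funM => //; apply: measurable_funB => //.
move=> t _; rewrite lee_fin [leRHS]ger0_norm ?mulr_ge0 ?invr_ge0 ?addr_ge0 //.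
rewrite cauchy_inv /= normrM normfV (ger0_norm (cabs2_ge0 _)).
by apply: bound => //; right.
Qed.

(** Pointwise [|1 / (t - l)|^2 = Im (1 / (t - l)) / Im l], so integrability of the kernel already
    gives square integrability. *)
Lemma cauchy_L2 mu l : Im l != 0 -> cintegrable mu (fun t => (t%:C%C - l)^-1) ->
  L2 mu (fun t => (t%:C%C - l)^-1).
Proof.
move=> l0 h; apply/L2_integrable; split; first exact: cintegrable_measurable h.
have -> : (fun t => (cabs2 (t%:C%C - l)^-1)%:E) =
    (fun t => ((Im l)^-1%:E * (Im (t%:C%C - l)^-1)%:E)%E).
  apply/funext => t; rewrite cauchy_inv /= -cauchy_inv cabs2V -EFinM; congr EFin.
  by rewrite mulKf.
by apply: integrableZl => //; case: h.
Qed.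

Lemma Im_borel_transform mu l : Im l != 0 ->
  cintegrable mu (fun t => (t%:C%C - l)^-1) ->
  Im (borel_transform mu l) =
  Im l * Rintegral mu setT (fun t => cabs2 (t%:C%C - l)^-1).
Proof.
move=> l0 h; rewrite -RintegralZl //; last by have /L2_integrable[] := cauchy_L2 l0 h.
apply: eq_Rintegral => t _.
by rewrite cauchy_inv /= -cauchy_inv cabs2V.
Qed.

Lemma borel_transformJ mu l : cintegrable mu (fun t => (t%:C%C - l)^-1) ->
  borel_transform mu (l^*)%C = ((borel_transform mu l)^*)%C.
Proof.
move=> h; rewrite -cintegralJ //; apply: eq_cintegral => t.
by rewrite cauchyJ.
Qed.

(** The integrand vanishes nowhere, so a zero integral would make the whole line a null set. *)
Lemma Rintegral_cauchy_gt0 mu l : mu setT != 0%E -> Im l != 0 ->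
  cintegrable mu (fun t => (t%:C%C - l)^-1) ->
  0 < Rintegral mu setT (fun t => cabs2 (t%:C%C - l)^-1).
Proof.
move=> mu0 l0 h; rewrite lt_neqAle Rintegral_ge0 ?andbT; last by move=> t _; exact: cabs2_ge0.
have /L2_integrable[m i] := cauchy_L2 l0 h.
apply: contra_neq mu0 => e.
have : (\int[mu]_t `|(cabs2 (t%:C%C - l)^-1)%:E|)%E = 0%E.
  under eq_integral do rewrite gee0_abs ?lee_fin ?cabs2_ge0 //.
  by rewrite -(fineK (integrable_fin_num _ i)) //; congr EFin.
move/(ae_eq_integral_abs _ measurableT (measurable_int _ i)) => [N [mN N0 sub]].
apply/eqP; rewrite -measure_le0 -N0 le_measure ?inE //.
move=> t _; apply: sub => /= /(_ I) /eqP.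
by rewrite eqe cabs2_eq0 invr_eq0 (negbTE (real_neq _ l0)).
Qed.

(** The imaginary part is [alpha * Im l] times a positive integral. *)
Lemma perturb_neq0 mu (alpha : R) l : mu setT != 0%E -> alpha != 0 -> Im l != 0 ->
  cintegrable mu (fun t => (t%:C%C - l)^-1) ->
  1 + alpha%:C%C * borel_transform mu l != 0.
Proof.
move=> mu0 a0 l0 h; rewrite -(subr0 (1 + _)); apply: neq_Im.
rewrite cImD cImM Im_borel_transform //= add0r mul0r addr0 !mulf_neq0 //.
by rewrite gt_eqF // Rintegral_cauchy_gt0.
Qed.

End CauchyKernel.

(** * Simple fractions and the isometry *)

Section SimpleFractions.
Variable R : realType.
Local Notation C := R[i].
Implicit Types (p : seq (C * C)) (y z w : C) (t s : R) (mu : {measure set R -> \bar R}).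
Local Notation Re := complex.Re.
Local Notation Im := complex.Im.

Lemma conj_perturb (c z : C) (a : R) :
  ((c * (1 + a%:C%C * z))^*)%C = (c^*)%C * (1 + a%:C%C * (z^*)%C).
Proof.
case: c z => [c1 c2] [z1 z2]; apply/eqP; rewrite eq_complex /=.
by apply/andP; split; apply/eqP; ring.
Qed.

(* A list of pairs [(c, l)] stands for the rational function [\sum c / (z - l)]. *)
Definition rsum p z : C := \sum_(q <- p) q.1 / (z - q.2).

Definition rscale (k : C) p := [seq (k * q.1, q.2) | q <- p].

(* Partial fractions of [rsum p z / (z - y)]. *)
Definition rdiv y p :=
  [seq (q.1 / (q.2 - y), q.2) | q <- p] ++ [seq (- (q.1 / (q.2 - y)), y) | q <- p].

(** Multiplication of the function by [1 + k / (z - y)]; with [k = 2 y - i eps] this is the factor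
    [v] of the proof idea. *)
Definition rtwist k y p := p ++ rscale k (rdiv y p).

Lemma rsum_cat p p' z : rsum (p ++ p') z = rsum p z + rsum p' z.
Proof. exact: big_cat. Qed.

Lemma rsum_scale k p z : rsum (rscale k p) z = k * rsum p z.
Proof. by rewrite /rsum big_map mulr_sumr; apply: eq_bigr => q _; rewrite mulrA. Qed.

Lemma rsum_div y p z : z != y -> {in p, forall q, q.2 != y} ->
  {in p, forall q, z != q.2} -> rsum (rdiv y p) z = rsum p z / (z - y).
Proof.
move=> zy py pz; rewrite rsum_cat /rsum !big_map -big_split mulr_suml.
apply: eq_big_seq => q qp /=.
have := py _ qp; have := pz _ qp; move: zy; rewrite -!(subr_eq0 _ y) -(subr_eq0 z q.2).
by move=> *; field; do ! (apply/andP; split).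
Qed.

Lemma rsum_twist k y p z : z != y -> {in p, forall q, q.2 != y} ->
  {in p, forall q, z != q.2} -> rsum (rtwist k y p) z = (1 + k / (z - y)) * rsum p z.
Proof.
by move=> zy py pz; rewrite rsum_cat rsum_scale rsum_div // mulrDl mul1r mulrA mulrAC.
Qed.

(** * Resolvent identities for the perturbation *)

Section Perturbation.
Variables (mu : {measure set R -> \bar R}) (alpha : R).
Let F := borel_transform mu.

(* [rsum (perturb p)] is the image of [rsum p] under the spectral
   representation from [L^2(mu)] to [L^2(mu_alpha)]. *)
Definition perturb p := [seq (q.1 * (1 + alpha%:C%C * F q.2), q.2) | q <- p].

(** A closed form of [alpha] times the integral of [rsum p t / (w - t)] against [mu]; at
    [w = s + i eps] it is [alpha * T_eps] applied to [rsum p]. Being a finite sum, it can be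
    manipulated by algebra alone. *)
Definition gsum p w := alpha%:C%C * \sum_(q <- p) q.1 * ((F q.2 - F w) / (w - q.2)).

Lemma perturb_cat p p' : perturb (p ++ p') = perturb p ++ perturb p'.
Proof. exact: map_cat. Qed.

Lemma perturb_scale k p : perturb (rscale k p) = rscale k (perturb p).
Proof. by rewrite /perturb /rscale -!map_comp; apply: eq_map => q /=; rewrite mulrA. Qed.

Lemma gsum_cat p p' w : gsum (p ++ p') w = gsum p w + gsum p' w.
Proof. by rewrite /gsum big_cat mulrDr. Qed.

Lemma gsum_scale k p w : gsum (rscale k p) w = k * gsum p w.
Proof.
rewrite /gsum big_map [RHS]mulrCA; congr (_ * _); rewrite mulr_sumr.
by apply: eq_bigr => q _; rewrite /= -mulrA.
Qed.

(** The resolvent identity relating the original and the perturbed operator: the map [V] turns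
    division by [t - y] into division by [s - y], up to the rank one correction [gsum p y]. *)
Lemma rsum_perturb_div y p z : z != y -> {in p, forall q, q.2 != y} ->
  {in p, forall q, z != q.2} ->
  rsum (perturb (rdiv y p)) z = (rsum (perturb p) z - gsum p y) / (z - y).
Proof.
move=> zy py pz; rewrite perturb_cat rsum_cat /rsum /perturb !big_map /gsum.
rewrite -big_split mulr_sumr -sumrB mulr_suml.
apply: eq_big_seq => q qp /=.
have := py _ qp; have := pz _ qp; move: zy; rewrite -!(subr_eq0 _ y) -(subr_eq0 z q.2).
move=> h1 h2 h3; have h4 : y - q.2 != 0 by rewrite -opprB oppr_eq0.
by field; do ! (apply/andP; split).
Qed.

(** It reflects the partial fractions of [1 / ((w - t) (t - y))]. The correction [gsum p y] is the
    one of [rsum_perturb_div], which allows cancellation in [defect_step]. *)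
Lemma gsum_div y p w : w != y -> {in p, forall q, q.2 != y} ->
  {in p, forall q, w != q.2} ->
  gsum (rdiv y p) w = (gsum p w - gsum p y) / (w - y).
Proof.
move=> zy py pz; rewrite gsum_cat /gsum !big_map.
rewrite -mulrDr -mulrBr -mulrA; congr (_ * _).
rewrite -big_split -sumrB mulr_suml.
apply: eq_big_seq => q qp /=.
have := py _ qp; have := pz _ qp; move: zy; rewrite -!(subr_eq0 _ y) -(subr_eq0 w q.2).
move=> h1 h2 h3; have h4 : y - q.2 != 0 by rewrite -opprB oppr_eq0.
by field; do ! (apply/andP; split).
Qed.

(** Each pole [l] contributes [1 / ((t - l) (w - t)) = (1 / (t - l) - 1 / (t - w)) / (w - l)], whose
    integral is a divided difference of [F]. *)
Lemma cintegral_rsum_gsum p w :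
  kernel_integrable mu -> {in p, forall q, Im q.2 != 0} -> Im w != 0 ->
  {in p, forall q, w != q.2} ->
  cintegral mu (fun t => rsum p t%:C%C / (w - t%:C%C)) =
  \sum_(q <- p) q.1 * ((F q.2 - F w) / (w - q.2)).
Proof.
move=> ki pr wr pw.
have e t : rsum p t%:C%C / (w - t%:C%C) = \sum_(q <- p)
    q.1 * ((w - q.2)^-1 * ((t%:C%C - q.2)^-1 + (-1) * (t%:C%C - w)^-1)).
  rewrite mulr_suml; apply: eq_big_seq => q qp.
  have h1 := real_neq t (pr _ qp); have h2 := real_neq t wr.
  have h3 : w - q.2 != 0 by rewrite subr_eq0 pw.
  have h4 : w - t%:C%C != 0 by rewrite -opprB oppr_eq0.
  by field; do ! (apply/andP; split).
have i1 q : q \in p -> cintegrable mu (fun t => (t%:C%C - q.2)^-1 + (-1) * (t%:C%C - w)^-1).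
  by move=> qp; apply: cintegrableD; [apply/ki/pr|apply/cintegrableZ/ki].
rewrite (eq_cintegral _ e) cintegral_sum; last first.
  by move=> q qp; apply/cintegrableZ/cintegrableZ/i1.
apply: eq_big_seq => q qp; rewrite cintegralZ; last exact/cintegrableZ/i1.
rewrite cintegralZ ?cintegralD ?cintegralZ;
  [|exact: ki|apply/ki/pr => //|exact/cintegrableZ/ki|exact: i1].
by rewrite mulN1r [_^-1 * _]mulrC.
Qed.

End Perturbation.

(* No pole is real and no two poles are conjugate. *)
Definition admissible p := {in p &, forall q q', Im q.2 + Im q'.2 != 0}.

Lemma admissible_Im p : admissible p -> {in p, forall q, Im q.2 != 0}.
Proof. by move=> h q qp; have := h _ _ qp qp; apply: contra_neq => ->; rewrite addr0. Qed.

Lemma rsum_L2 mu p : kernel_integrable mu -> {in p, forall q, Im q.2 != 0} ->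
  L2 mu (fun t => rsum p t%:C%C).
Proof. by move=> ki h; apply: L2_sum => q qp; apply/L2Z/cauchy_L2; [|apply: ki]; exact: h. Qed.

(** The Gram matrix of Cauchy kernels consists of divided differences of the Borel transform at [l]
    and the conjugate of [l']; admissibility keeps these two points apart. *)
Lemma Rintegral_rsum mu p : kernel_integrable mu -> admissible p ->
  (Rintegral mu setT (fun t => cabs2 (rsum p t%:C%C)))%:C%C =
  \sum_(q <- p) \sum_(q' <- p) q.1 * (q'.1^*)%C *
    ((borel_transform mu q.2 - borel_transform mu (q'.2^*)%C) / (q.2 - (q'.2^*)%C)).
Proof.
move=> ki adm; have nr := admissible_Im adm.
have nrJ q : q \in p -> Im (q.2^*)%C != 0 by move=> qp; rewrite cImJ oppr_eq0 nr.
have dJ q q' : q \in p -> q' \in p -> q.2 - (q'.2^*)%C != 0.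
  by move=> qp qp'; apply: neq_Im; rewrite cImJ -addr_eq0 adm.
rewrite -cintegral_real.
have e t : (cabs2 (rsum p t%:C%C))%:C%C = \sum_(q <- p) \sum_(q' <- p)
    (q.1 * (q'.1^*)%C * (q.2 - (q'.2^*)%C)^-1) *
     ((t%:C%C - q.2)^-1 + (-1) * (t%:C%C - (q'.2^*)%C)^-1).
  rewrite cabs2E /rsum rmorph_sum mulr_suml; apply: eq_big_seq => q qp.
  rewrite mulr_sumr; apply: eq_big_seq => q' qp'.
  rewrite -[X in _ * X = _]/(((q'.1 / (t%:C%C - q'.2))^*)%C).
  have -> : ((q'.1 / (t%:C%C - q'.2))^*)%C = (q'.1^*)%C / (t%:C%C - (q'.2^*)%C).
    by rewrite [LHS]rmorphM; congr (_ * _); exact: cauchyJ.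
  have h1 := real_neq t (nr _ qp); have h2 := real_neq t (nrJ _ qp').
  have h3 := dJ _ _ qp qp'.
  by field; do ! (apply/andP; split).
have i1 q q' : q \in p -> q' \in p ->
    cintegrable mu (fun t => (t%:C%C - q.2)^-1 + (-1) * (t%:C%C - (q'.2^*)%C)^-1).
  by move=> qp qp'; apply: cintegrableD; [apply/ki/nr|apply/cintegrableZ/ki/nrJ].
rewrite (eq_cintegral _ e) cintegral_sum; last first.
  by move=> q qp; apply: cintegrable_sum => q' qp'; apply/cintegrableZ/i1.
apply: eq_big_seq => q qp; rewrite cintegral_sum; last first.
  by move=> q' qp'; apply/cintegrableZ/i1.
apply: eq_big_seq => q' qp'; rewrite cintegralZ; last exact: i1.
rewrite cintegralD; [|apply/ki/nr => //|apply/cintegrableZ/ki/nrJ => //].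
rewrite cintegralZ; last by apply/ki/nrJ.
by rewrite mulN1r -!mulrA; congr (_ * (_ * _)); rewrite mulrC.
Qed.

(** For [G = F / (1 + alpha F)] one has [G(l) - G(l') = (F(l) - F(l')) / ((1 + alpha F(l)) (1 +
    alpha F(l')))], so the weights put in by [perturb] cancel in every Gram entry. *)
Lemma perturb_isometry mu (alpha : R) (mua : {measure set R -> \bar R}) p :
  mu setT != 0%E -> alpha != 0 -> kernel_integrable mu -> is_mu_alpha mu alpha mua ->
  admissible p ->
  Rintegral mua setT (fun t => cabs2 (rsum (perturb mu alpha p) t%:C%C)) =
  Rintegral mu setT (fun t => cabs2 (rsum p t%:C%C)).
Proof.
move=> mu0 a0 ki mua_def adm; have nr := admissible_Im adm.
have kia : kernel_integrable mua by move=> l /mua_def[].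
have nrJ q : q \in p -> Im (q.2^*)%C != 0 by move=> qp; rewrite cImJ oppr_eq0 nr.
have adm' : admissible (perturb mu alpha p).
  by move=> _ _ /mapP[q qp ->] /mapP[q' qp' ->] /=; exact: adm.
apply: (@complexI R); rewrite !Rintegral_rsum // /perturb big_map.
apply: eq_big_seq => q qp; rewrite big_map; apply: eq_big_seq => q' qp' /=.
rewrite !(mua_def _ _).2 ?nr ?nrJ //.
rewrite conj_perturb -borel_transformJ; last exact/ki/nr.
have h1 := perturb_neq0 mu0 a0 (nr _ qp) (ki _ (nr _ qp)).
have h2 := perturb_neq0 mu0 a0 (nrJ _ qp') (ki _ (nrJ _ qp')).
have h3 : q.2 - (q'.2^*)%C != 0 by apply: neq_Im; rewrite cImJ -addr_eq0 adm.
by field; do ! (apply/andP; split).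
Qed.

End SimpleFractions.

(** * Telescoping *)

Section Telescoping.
Variables (R : realType) (mu : {measure set R -> \bar R}) (alpha : R).
Variables (mua : {measure set R -> \bar R}) (eps : R).
Hypothesis mu0 : mu setT != 0%E.
Hypothesis alpha0 : alpha != 0.
Hypothesis ki : kernel_integrable mu.
Hypothesis mua_def : is_mu_alpha mu alpha mua.
Hypothesis eps0 : eps != 0.
Local Notation C := R[i].
Local Notation Re := complex.Re.
Local Notation Im := complex.Im.
Implicit Types (p : seq (C * C)) (t s : R).

(* Simple fractions only represent simple poles, so each step of the telescoping
   needs a new pole; they stay bounded and off the line [Im = eps]. *)
Definition rho (n : nat) : R := 2 + n.+1%:R^-1.

Definition pole (n : nat) : C := (0 +i* (rho n * eps))%C.

(** A bound for all the factors [|v|^2 = 1 - (2 rho - 1) eps^2 / (t^2 + rho^2 eps^2)] at once: for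
    [rho] in [[2, 3]] the least numerator has [3 = 2 * 2 - 1] and the largest denominator has
    [9 = 3^2]. *)
Definition damping t : R := 1 - 3 * eps ^+ 2 / (t ^+ 2 + 9 * eps ^+ 2).

(** The invariant after [n] steps: poles lie on the line of the kernels paired with by [T_eps], or
    among the [n] poles already spent. *)
Definition good (n : nat) p :=
  {in p, forall q, Im q.2 = - eps \/ exists2 k, (k < n)%N & q.2 = pole k}.

Let d : C := (0 +i* eps)%C.
Let kappa n : C := pole n *+ 2 - d.
Let m n : R := (2 * rho n - 1) * eps ^+ 2.
(* [alpha * T_eps - V] applied to [rsum p]. *)
Let defect p s : C := gsum mu alpha p (s%:C%C + d) - rsum (perturb mu alpha p) s%:C%C.

Lemma rho_ge2 n : 2 <= rho n.
Proof. by rewrite lerDl invr_ge0. Qed.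

Lemma rho_le3 n : rho n <= 3.
Proof.
rewrite /rho -[3]/(2 + 1)%:R natrD lerD2l invf_le1 ?ltr0n //.
by rewrite ler1n.
Qed.

Lemma eps2_gt0 : 0 < eps ^+ 2.
Proof. by rewrite exprn_even_gt0. Qed.

Lemma m_gt0 n : 0 < m n.
Proof. by rewrite mulr_gt0 ?eps2_gt0 //; have := rho_ge2 n; lra. Qed.

Lemma pole_inj k n : pole k = pole n -> k = n.
Proof.
case=> /(mulIf eps0) /addrI /invr_inj /eqP.
by rewrite eqr_nat => /eqP [].
Qed.

Lemma good_Im n p q : good n p -> q \in p -> exists2 r, Im q.2 = r * eps & r = -1 \/ 2 <= r.
Proof.
move=> gp /gp [->|[k _ ->]]; first by exists (-1); [rewrite mulN1r|left].
by exists (rho k) => //; right; exact: rho_ge2.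
Qed.

(** In units of [eps] the imaginary parts are [-1] or at least [2], so no two of them add up to
    zero. *)
Lemma good_admissible n p : good n p -> admissible p.
Proof.
move=> gp q q' /(good_Im gp)[r -> hr] /(good_Im gp)[r' -> hr'].
by rewrite -mulrDl mulf_neq0 //; case: hr hr' => [->|?] [->|?]; apply/eqP; lra.
Qed.

Lemma good_neq_pole n p : good n p -> {in p, forall q, q.2 != pole n}.
Proof.
move=> gp q /gp [h|[k kn ->]].
  rewrite -subr_eq0; apply: neq_Im; rewrite h /= -mulN1r (inj_eq (mulIf eps0)).
  by have := rho_ge2 n => ?; apply/eqP; lra.
by apply/negP => /eqP /pole_inj ?; subst k; rewrite ltnn in kn.
Qed.

Lemma good_neq_line n p s : good n p -> {in p, forall q, s%:C%C + d != q.2}.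
Proof.
move=> gp q /(good_Im gp)[r h hr]; rewrite -subr_eq0; apply: neq_Im.
rewrite h /= add0r -[X in X != _]mul1r (inj_eq (mulIf eps0)).
by case: hr => [->|?]; apply/eqP; lra.
Qed.

Lemma good_neq_real n p s : good n p -> {in p, forall q, s%:C%C != q.2}.
Proof.
move=> gp q qp; rewrite -subr_eq0 real_neq //.
exact: admissible_Im (good_admissible gp) _ qp.
Qed.

Lemma pole_Im n : Im (pole n) != 0.
Proof. by rewrite /= mulf_neq0 //; have := rho_ge2 n => ?; apply/eqP; lra. Qed.

Lemma real_neq_pole n s : s%:C%C != pole n.
Proof. by rewrite -subr_eq0 real_neq // pole_Im. Qed.

Lemma line_neq_pole n s : s%:C%C + d != pole n.
Proof.
rewrite -subr_eq0; apply: neq_Im => /=.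
rewrite add0r -[X in X != _]mul1r (inj_eq (mulIf eps0)).
by have := rho_ge2 n => ?; apply/eqP; lra.
Qed.

Lemma good_div n p : good n p -> good n.+1 (rdiv (pole n) p).
Proof.
move=> gp q; rewrite mem_cat => /orP[] /mapP[q' /gp h ->] /=; last by right; exists n.
by case: h => [|[k kn ->]]; [left|right; exists k => //; exact: ltnW].
Qed.

Lemma good_twist k n p : good n p -> good n.+1 (rtwist k (pole n) p).
Proof.
move=> gp q; rewrite mem_cat => /orP[/gp|/mapP[q' /(good_div gp) h ->] //].
by case=> [|[j jn ->]]; [left|right; exists j => //; exact: ltnW].
Qed.

(** With [y = i rho eps] this is [(rho - 1)^2 + (2 rho - 1) = rho^2]. It splits the energy of [f]
    into that of [v f] and [m] times that of [f / (t - y)]. *)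
Lemma twist_norm n t :
  cabs2 (1 + kappa n / (t%:C%C - pole n)) + m n * cabs2 (t%:C%C - pole n)^-1 = 1.
Proof.
have h := real_neq t (pole_Im n).
have -> : 1 + kappa n / (t%:C%C - pole n) = (t%:C%C + pole n - d) / (t%:C%C - pole n).
  by rewrite /kappa; field.
rewrite cabs2M cabs2V -mulrDl.
have -> : cabs2 (t%:C%C + pole n - d) + m n = cabs2 (t%:C%C - pole n).
  by rewrite /cabs2 /m /=; ring.
by rewrite mulfV // cabs2_eq0.
Qed.

Lemma twist_le n t : cabs2 (1 + kappa n / (t%:C%C - pole n)) <= damping t.
Proof.
rewrite -(addrK (m n * cabs2 (t%:C%C - pole n)^-1) (cabs2 _)) twist_norm.
rewrite lerD2l lerN2 cabs2V.
have -> : cabs2 (t%:C%C - pole n) = t ^+ 2 + rho n ^+ 2 * eps ^+ 2.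
  by rewrite /cabs2 /=; ring.
have r2 := rho_ge2 n; have r3 := rho_le3 n; have e2 := eps2_gt0.
have t2 := sqr_ge0 t.
have p1 : 0 < t ^+ 2 + 9 * eps ^+ 2 by rewrite ltr_wpDl // mulr_gt0.
have p2 : 0 < t ^+ 2 + rho n ^+ 2 * eps ^+ 2.
  by rewrite ltr_wpDl // mulr_gt0 // exprn_gt0 // (lt_le_trans _ r2).
rewrite ler_pdivrMr // mulrAC ler_pdivlMr //.
rewrite /m [leLHS]mulrAC [leRHS]mulrAC ler_pM2r //.
have h1 : 0 <= (rho n - 2) * t ^+ 2 by rewrite mulr_ge0 // subr_ge0.
(* After clearing denominators, [h1] compares the coefficients of [t^2] and [h2] those of [eps^2];
   the latter holds because [rho^2 - 6 rho + 3 <= 0] on [[2, 3]]. *)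
have h2 : 3 * rho n ^+ 2 <= (2 * rho n - 1) * 9 by nra.
have := ler_wpM2r (ltW e2) h2; nra.
Qed.

Lemma defect_step n p s : good n p ->
  defect p s = (s%:C%C + d - pole n) / (s%:C%C + pole n) *
     defect (rtwist (kappa n) (pole n) p) s
   - (m n)%:C%C / (s%:C%C + pole n) * rsum (perturb mu alpha (rdiv (pole n) p)) s%:C%C.
Proof.
move=> gp.
have h1 := real_neq s (pole_Im n).
have h2 : s%:C%C + pole n != 0.
  rewrite -(opprK (pole n)) real_neq //.
  by have := pole_Im n; rewrite /= oppr_eq0.
have h3 : s%:C%C + d - pole n != 0 by rewrite subr_eq0 line_neq_pole.
(* This value of [m] is what makes the terms [gsum p (pole n)], produced by both division rules,
   cancel. *)
have mE : (m n)%:C%C = - (kappa n * d).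
  by apply/eqP; rewrite eq_complex /m /=; apply/andP; split; apply/eqP; ring.
rewrite mE /defect /rtwist perturb_cat rsum_cat gsum_cat perturb_scale rsum_scale gsum_scale.
rewrite gsum_div ?line_neq_pole //; [|exact: good_neq_pole gp|exact: good_neq_line gp].
rewrite rsum_perturb_div ?real_neq_pole //; [|exact: good_neq_pole gp|exact: good_neq_real gp].
rewrite /kappa.
by field; do ! (apply/andP; split).
Qed.

Lemma defect_weights n s :
  cabs2 ((s%:C%C + d - pole n) / (s%:C%C + pole n)) +
  cabs2 ((m n)%:C%C / (s%:C%C + pole n)) / m n = 1.
Proof.
have h2 : s%:C%C + pole n != 0.
  rewrite -(opprK (pole n)) real_neq //.
  by have := pole_Im n; rewrite /= oppr_eq0.
rewrite !cabs2M !cabs2V cabs2_real mulrAC expr2 mulfK ?gt_eqF ?m_gt0 // -mulrDl.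
have -> : cabs2 (s%:C%C + d - pole n) + m n = cabs2 (s%:C%C + pole n).
  by rewrite /cabs2 /m /=; ring.
by rewrite mulfV // cabs2_eq0.
Qed.

(** Induction on the number of Cayley steps. [U] is the product of the factors [u], [A] collects the
    terms in [V], and [phi] sums the energies [m |V (f / (t - y))|^2] together with the last
    [|V f|^2]. Its integral is exactly the energy of [rsum p], since every step preserves the
    total. *)
Lemma telescoping (N n : nat) p : good n p -> exists p' (phi : R -> R),
  [/\ good (n + N) p',
      forall t, cabs2 (rsum p' t%:C%C) <= damping t ^+ N * cabs2 (rsum p t%:C%C),
      mua.-integrable setT (EFin \o phi),
      Rintegral mua setT phi = Rintegral mu setT (fun t => cabs2 (rsum p t%:C%C)) &
      forall s, exists A U : C, [/\ defect p s = A + U * gsum mu alpha p' (s%:C%C + d),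
        cabs2 U <= 1 & cabs2 A <= phi s]].
Proof.
have kia : kernel_integrable mua by move=> l /mua_def[].
have iR nu k q : kernel_integrable nu -> good k q ->
    nu.-integrable setT (fun t => (cabs2 (rsum q t%:C%C))%:E).
  move=> hn gq; have L := rsum_L2 hn (admissible_Im (good_admissible gq)).
  by have [] := (L2_integrable nu _).1 L.
have gP k q : good k q -> good k (perturb mu alpha q).
  by move=> gq _ /mapP[q' /gq h ->].
elim: N n p => [|N ih] n p gp.
  exists p, (fun s => cabs2 (rsum (perturb mu alpha p) s%:C%C)); split.
  - by rewrite addn0.
  - by move=> t; rewrite expr0 mul1r.
  - exact: iR kia (gP _ _ gp).
  - exact: (perturb_isometry mu0 alpha0 ki mua_def (good_admissible gp)).
  - move=> s; exists (- rsum (perturb mu alpha p) s%:C%C), 1; split.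
    + by rewrite mul1r addrC.
    + by rewrite /cabs2 /= expr1n expr0n addr0.
    + by rewrite cabs2N.
set p1 := rtwist (kappa n) (pole n) p.
have g1 : good n.+1 p1 by exact: good_twist.
have gd := good_div gp.
have [p' [phi [gp' dp' iphi ephi hphi]]] := ih _ _ g1.
have rp1 t : rsum p1 t%:C%C = (1 + kappa n / (t%:C%C - pole n)) * rsum p t%:C%C.
  rewrite rsum_twist ?real_neq_pole //; [exact: good_neq_pole gp|exact: good_neq_real gp].
have d0 t : 0 <= damping t by rewrite (le_trans (cabs2_ge0 _) (twist_le 0 t)).
pose psi s := cabs2 (rsum (perturb mu alpha (rdiv (pole n) p)) s%:C%C).
have ipsi : mua.-integrable setT (EFin \o psi) by exact: iR kia (gP _ _ gd).
have impsi := EFin_integrableZ (m n) ipsi.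
exists p', (fun s => phi s + m n * psi s); split.
- by rewrite addnS -addSn.
- move=> t; rewrite (le_trans (dp' t)) // exprSr -mulrA rp1 cabs2M.
  by rewrite ler_wpM2l ?exprn_ge0 // ler_wpM2r ?cabs2_ge0 // twist_le.
- exact: EFin_integrableD.
(* The isometry moves the new energy to [mu], where [twist_norm] adds it to the energy of [p1]
   pointwise. *)
- rewrite RintegralD // RintegralZl // ephi.
  rewrite /psi (perturb_isometry mu0 alpha0 ki mua_def (good_admissible gd)).
  have i1 := iR mu _ _ ki g1; have i2 := iR mu _ _ ki gd.
  rewrite -RintegralZl // -RintegralD //; last exact: EFin_integrableZ.
  apply: eq_Rintegral => t _; rewrite rp1 cabs2M.
  rewrite rsum_div ?real_neq_pole //; [|exact: good_neq_pole gp|exact: good_neq_real gp].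
  by rewrite cabs2M mulrCA [_ * cabs2 (rsum p _)]mulrC -mulrDr twist_norm mulr1.
- move=> s; have [A [U [e U1 hA]]] := hphi s.
  set u := (s%:C%C + d - pole n) / (s%:C%C + pole n).
  set r := (m n)%:C%C / (s%:C%C + pole n).
  have w := defect_weights n s; rewrite -/u -/r in w.
  exists (u * A - r * rsum (perturb mu alpha (rdiv (pole n) p)) s%:C%C), (u * U); split.
  + by rewrite (defect_step s gp) -/p1 e -/u -/r; ring.
  + rewrite cabs2M mulr_ile1 ?cabs2_ge0 // -w lerDl divr_ge0 ?cabs2_ge0 //.
    by rewrite ltW // m_gt0.
  + by rewrite (le_trans (cabs2_convex_le _ _ (m_gt0 n) w)) // lerD2r.
Qed.

End Telescoping.

(** * Integral inequalities *)

Section ExtendedIntegrals.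
Variable R : realType.
Implicit Types (u : (\bar R)^nat) (x c : R).

Lemma harmonic_le (c e : R) : 0 <= c -> 0 < e ->
  exists n, forall k, (n <= k)%N -> c / k.+1%:R <= e.
Proof.
move=> c0 e0; exists (Num.bound (c / e)) => k nk.
rewrite ler_pdivrMr ?ltr0n // mulrC -ler_pdivrMr //.
have := archi_boundP (divr_ge0 c0 (ltW e0)) => /ltW /le_trans; apply.
by rewrite ler_nat (leq_trans nk).
Qed.

(** Together with the next lemma, this passes to the lower limit when only one-sided bounds with
    error [c / (n + 1)] are available and [u] itself may have no limit. *)
Lemma limn_einf_ge u x c : 0 <= c ->
  (forall n, ((x - c / n.+1%:R)%:E <= u n)%E) -> (x%:E <= limn_einf u)%E.
Proof.
move=> c0 h; apply/lee_subgt0Pr => e e0.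
have [n hn] := harmonic_le c0 e0.
rewrite limn_einf_lim (cvg_lim _ (@cvg_einfs_sup R u)) //.
apply: (@le_trans _ _ (einfs u n)); last by apply: ereal_sup_ubound; exists n.
apply: le_ereal_inf_tmp => _ [k /= nk <-].
by apply: le_trans (h k); rewrite -EFinB lee_fin lerB // hn.
Qed.

Lemma limn_einf_le u x c : 0 <= c ->
  (forall n, (u n <= (x + c / n.+1%:R)%:E)%E) -> (limn_einf u <= x%:E)%E.
Proof.
move=> c0 h; apply/lee_addgt0Pr => e e0.
have [n hn] := harmonic_le c0 e0.
rewrite limn_einf_lim (cvg_lim _ (@cvg_einfs_sup R u)) //.
apply: ge_ereal_sup => _ [k _ <-].
apply: (@le_trans _ _ (u (maxn k n))).
  by apply: ereal_inf_lbound; exists (maxn k n) => //=; rewrite leq_maxl.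
by apply: le_trans (h _) _; rewrite -EFinD lee_fin lerD2l hn // leq_maxr.
Qed.

(* Holds without measurability because the integral of a nonnegative function is a
   supremum over the simple functions below it. *)
Lemma ge0_integral_mono (nu : {measure set R -> \bar R}) (f g : R -> \bar R) :
  (forall t, (0 <= f t)%E) -> (forall t, (f t <= g t)%E) ->
  (\int[nu]_t f t <= \int[nu]_t g t)%E.
Proof.
move=> f0 fg; have g0 t : (0 <= g t)%E by exact: le_trans (f0 t) (fg t).
rewrite !ge0_integralTE //; apply: ereal_sup_le => _ [h hf <-]; exists h => // t.
exact: le_trans (hf t) (fg t).
Qed.

(** Dominated convergence with dominating function [g]: [q] is below 1 at each point, though perhaps
    not uniformly. *)
Lemma Rintegral_pow_vanish (nu : {measure set R -> \bar R}) (q g : R -> R) (del : R) :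
  measurable_fun setT q -> (forall t, 0 <= q t < 1) -> (forall t, 0 <= g t) ->
  nu.-integrable setT (EFin \o g) -> 0 < del ->
  exists N, Rintegral nu setT (fun t => q t ^+ N * g t) <= del.
Proof.
move=> mq q01 g0 ig d0.
have mg : measurable_fun setT g by apply/measurable_EFinP; exact: measurable_int ig.
have mN n : measurable_fun setT (fun t => (q t ^+ n * g t)%:E).
  by apply/measurable_EFinP; apply: measurable_funM => //; exact: measurable_funX.
have := @dominated_convergence _ _ R nu setT measurableT
  (fun n t => (q t ^+ n * g t)%:E) (fun=> 0%E) (EFin \o g) mN (measurable_cst _).
case=> //.
- apply: aeW => t _; apply: cvg_EFin; first exact: nearW.
  rewrite -(mul0r (g t)); apply: cvgM; last exact: cvg_cst.
  by apply: cvg_expr; have /andP[? ?] := q01 t; rewrite ger0_norm.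
- apply: aeW => t n _ /=; have /andP[q0 q1] := q01 t.
  rewrite lee_fin ger0_norm ?mulr_ge0 ?exprn_ge0 //.
  by rewrite ler_piMl // exprn_ile1 // ltW.
move=> _ _; rewrite integral0 => /fine_cvgP [_ /cvgrPdist_lt /(_ _ d0)] [N _ /(_ N (leqnn _))].
rewrite /= sub0r normrN => /ltW h; exists N.
exact: le_trans (ler_norm _) h.
Qed.

End ExtendedIntegrals.

(** * Near-orthogonality and pairings with Cauchy kernels *)

Section Orthogonality.
Variables (R : realType) (mu : {measure set R -> \bar R}).
Local Notation Re := complex.Re.
Local Notation Im := complex.Im.
Implicit Types f g : R -> R[i].

Definition norm2 f : R := Rintegral mu setT (fun t => cabs2 (f t)).

Lemma norm2_ge0 f : 0 <= norm2 f.
Proof. by apply: Rintegral_ge0 => t _; exact: cabs2_ge0. Qed.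

Lemma norm2D_scale f g c : L2 mu f -> L2 mu g ->
  norm2 (fun t => f t + c * g t) =
  norm2 f + 2 * Re ((c^*)%C * cintegral mu (fun t => f t * ((g t)^*)%C)) + cabs2 c * norm2 g.
Proof.
move=> hf hg; have ifg := L2M_cintegrable hf (L2J hg).
have [_ if2] := (L2_integrable _ _).1 hf; have [_ ig2] := (L2_integrable _ _).1 hg.
have [ir _] := cintegrableZ (c^*)%C ifg.
rewrite -cintegralZ //= /norm2 -!RintegralZl // -!RintegralD //; try exact: EFin_integrableZ.
  apply: eq_Rintegral => t _; case: (f t) (g t) c {ir} => [a b] [u v] [x y].
  by rewrite /cabs2 /=; ring.
by apply: EFin_integrableD => //; exact: EFin_integrableZ.
Qed.

(* With [del = norm2 f] this is the Cauchy-Schwarz inequality; in general it says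
   that an almost optimal approximation error is almost orthogonal to [g]. *)
Lemma almost_orthogonal f g (del : R) : L2 mu f -> L2 mu g -> 0 < norm2 g ->
  (forall c, norm2 f - del <= norm2 (fun t => f t + c * g t)) ->
  cabs2 (cintegral mu (fun t => f t * ((g t)^*)%C)) <= del * norm2 g.
Proof.
move=> hf hg g0; set z := cintegral _ _ => h.
(* This coefficient minimizes the squared norm of [f + c g]; the minimum is
   [norm2 f - cabs2 z / norm2 g]. *)
have := h (- (((norm2 g)^-1)%:C%C * z)); rewrite norm2D_scale // -/z => {}h.
have e1 : Re (((- (((norm2 g)^-1)%:C%C * z))^*)%C * z) = - (cabs2 z / norm2 g).
  by case: (z) => a b; rewrite /cabs2 /=; ring.
rewrite e1 cabs2N cabs2M cabs2_real in h.
have e2 : (norm2 g)^-1 ^+ 2 * cabs2 z * norm2 g = cabs2 z / norm2 g.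
  by field; rewrite gt_eqF.
rewrite e2 in h; rewrite -ler_pdivrMr //; lra.
Qed.

(** Up to sign, the integral is the inner product of [f] with the kernel whose pole is the conjugate
    of [w], so [almost_orthogonal] applies. *)
Lemma cauchy_pairing f (w : R[i]) (del : R) : mu setT != 0%E -> kernel_integrable mu ->
  Im w != 0 -> L2 mu f ->
  (forall c, norm2 f - del <= norm2 (fun t => f t + c * (t%:C%C - (w^*)%C)^-1)) ->
  cabs2 (cintegral mu (fun t => f t / (w - t%:C%C))) <=
    del * norm2 (fun t => (t%:C%C - (w^*)%C)^-1).
Proof.
move=> mu0 ki w0 hf h.
have w0' : Im (w^*)%C != 0 by rewrite cImJ oppr_eq0.
have kL := cauchy_L2 w0' (ki _ w0').
apply: le_trans (almost_orthogonal hf kL (Rintegral_cauchy_gt0 mu0 w0' (ki _ w0')) h).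
rewrite [leRHS](_ : _ = cabs2 (cintegral mu (fun t => f t / (w - t%:C%C)))) //.
rewrite -[LHS]cabs2N -mulN1r -cintegralZ; last exact: L2M_cintegrable hf (L2J kL).
congr (cabs2 _); apply: eq_cintegral => t.
by rewrite cauchyJ conjcK mulN1r -mulrN -invrN opprB.
Qed.

End Orthogonality.

(** * The uniform bound *)

Section UniformBound.
Variables (R : realType) (mu : {measure set R -> \bar R}) (alpha : R).
Variables (mua : {measure set R -> \bar R}) (eps : R).
Hypothesis mu0 : mu setT != 0%E.
Hypothesis alpha0 : alpha != 0.
Hypothesis ki : kernel_integrable mu.
Hypothesis mua_def : is_mu_alpha mu alpha mua.
Hypothesis eps0 : eps != 0.
Local Notation C := R[i].
Local Notation Re := complex.Re.
Local Notation Im := complex.Im.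
Implicit Types (p : seq (C * C)) (t s : R).

Let line s : C := s%:C%C + (0 +i* eps)%C.
(** The squared norm of the kernel that [T_eps] pairs with at [s]. It only occurs multiplied by
    [del], which tends to 0 for fixed [s] before any integration in [s]. *)
Let E s : R := norm2 mu (fun t => (t%:C%C - ((line s)^*)%C)^-1).

Lemma Im_line s : Im (line s) = eps.
Proof. by rewrite /= add0r. Qed.

Lemma measurable_damping : measurable_fun setT (damping eps).
Proof.
apply: measurable_funB => //; apply: measurable_funM => //.
apply: measurable_fun_continuousV => t.
  apply: cvgD; last exact: cvg_cst.
  by apply: (@cvgM _ _ _ _ id id); exact: cvg_id.
by rewrite gt_eqF // ltr_wpDl ?sqr_ge0 // mulr_gt0 // eps2_gt0.
Qed.

Lemma damping_bounds t : 0 <= damping eps t < 1.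
Proof.
have e2 := eps2_gt0 eps0; have t2 := sqr_ge0 t.
have p1 : 0 < t ^+ 2 + 9 * eps ^+ 2 by rewrite ltr_wpDl // mulr_gt0.
rewrite /damping subr_ge0 ler_pdivrMr // mul1r; apply/andP; split; first by nra.
by rewrite ltrBlDr ltrDl divr_gt0 // mulr_gt0.
Qed.

(** The number of steps is chosen after [p], so that the damped remainder [p'] has energy at most
    [del]. Then [gsum p] is [V p + A] plus [U] times [gsum p'], and the last term is small by
    Cauchy-Schwarz. *)
Lemma gsum_bound p (del : R) : good eps 0 p -> 0 < del ->
  exists phi : R -> R, [/\ mua.-integrable setT (EFin \o phi), (forall s, 0 <= phi s),
    Rintegral mua setT phi <= 8 * norm2 mu (fun t => rsum p t%:C%C) &
    forall s, cabs2 (gsum mu alpha p (line s)) <= phi s + 2 * alpha ^+ 2 * del * E s].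
Proof.
move=> gp d0; have adm := good_admissible eps0 gp.
have kia : kernel_integrable mua by move=> l /mua_def[].
have pL := rsum_L2 ki (admissible_Im adm).
have [_ ip] := (L2_integrable _ _).1 pL.
have [N hN] := Rintegral_pow_vanish measurable_damping damping_bounds
  (fun t => cabs2_ge0 (rsum p t%:C%C)) ip d0.
have [p' [phi [gp' dp' iphi ephi hphi]]] :=
  telescoping mu0 alpha0 ki mua_def eps0 N gp.
have p'L := rsum_L2 ki (admissible_Im (good_admissible eps0 gp')).
have [_ ip'] := (L2_integrable _ _).1 p'L.
have small : norm2 mu (fun t => rsum p' t%:C%C) <= del.
  apply: le_trans hN; apply: le_Rintegral => //.
  apply: (le_integrable _ _ _ ip) => //.
    apply/measurable_EFinP; apply: measurable_funM.
      by apply: measurable_funX; exact: measurable_damping.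
    by apply/measurable_EFinP; exact: measurable_int ip.
  move=> t _; have /andP[q0 /ltW q1] := damping_bounds t.
  rewrite lee_fin !ger0_norm ?mulr_ge0 ?exprn_ge0 ?cabs2_ge0 //.
  by rewrite ler_piMl ?cabs2_ge0 // exprn_ile1.
have admv : admissible (perturb mu alpha p).
  by move=> _ _ /mapP[q qp ->] /mapP[q' qp' ->] /=; exact: adm.
have vL := rsum_L2 kia (admissible_Im admv).
have [_ iv] := (L2_integrable _ _).1 vL.
pose V s := cabs2 (rsum (perturb mu alpha p) s%:C%C).
have phi0 s : 0 <= phi s.
  by have [A [U [_ _ h]]] := hphi s; exact: le_trans (cabs2_ge0 _) h.
have iVphi : mua.-integrable setT (EFin \o (fun s => V s + phi s)).
  exact: EFin_integrableD.
(* The factor 4 comes from using [cabs2D_le] twice; [V] and [phi] both integrate to the energy of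
   [p], whence the constant 8. *)
exists (fun s => 4 * (V s + phi s)); split.
- exact: EFin_integrableZ.
- by move=> s; rewrite mulr_ge0 // addr_ge0 // cabs2_ge0.
- rewrite RintegralZl // RintegralD // ephi /V.
  rewrite (perturb_isometry mu0 alpha0 ki mua_def adm) -/(norm2 mu _).
  by lra.
- move=> s; have [A [U [e U1 hA]]] := hphi s.
  have -> : gsum mu alpha p (line s) =
      (rsum (perturb mu alpha p) s%:C%C + A) + U * gsum mu alpha p' (line s).
    by rewrite -addrA -e addrC subrK.
  have h1 : cabs2 (gsum mu alpha p' (line s)) <= alpha ^+ 2 * (del * E s).
    have w0 : Im (line s) != 0 by rewrite Im_line.
    rewrite /gsum -cintegral_rsum_gsum //; last 2 first.
      exact: admissible_Im (good_admissible eps0 gp').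
      exact: good_neq_line gp'.
    rewrite cabs2M cabs2_real ler_wpM2l ?sqr_ge0 //.
    (* As [del] exceeds the whole energy of [p'], the minimality condition holds trivially and the
       pairing bound is plain Cauchy-Schwarz. *)
    apply: cauchy_pairing => // c.
    by rewrite (le_trans _ (norm2_ge0 _ _)) // subr_le0.
  apply: le_trans (cabs2D_le _ _) _.
  have h2 : cabs2 (U * gsum mu alpha p' (line s)) <= cabs2 (gsum mu alpha p' (line s)).
    by rewrite cabs2M ler_piMl ?cabs2_ge0.
  have h3 := cabs2D_le (rsum (perturb mu alpha p) s%:C%C) A.
  rewrite -/(V s) in h3; lra.
Qed.

(** The list [p] nearly attains the infimum of the energy of [f + rsum p] over poles on [Im = -eps].
    This family is stable under adding a kernel with pole at the conjugate of [line s], so such a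
    kernel gains at most [del]. *)
Lemma almost_minimizer f (del : R) : L2 mu f -> 0 < del ->
  exists p, [/\ good eps 0 p, norm2 mu (fun t => rsum p t%:C%C) <= 4 * norm2 mu f + 2 * del &
    forall s c, norm2 mu (fun t => f t + rsum p t%:C%C) - del <=
      norm2 mu (fun t => f t + rsum p t%:C%C + c * (t%:C%C - ((line s)^*)%C)^-1)].
Proof.
move=> hf d0.
have gL p : good eps 0 p -> L2 mu (fun t => rsum p t%:C%C).
  by move=> gp; exact: (rsum_L2 ki (admissible_Im (good_admissible eps0 gp))).
pose S := [set x | exists2 p, good eps 0 p & x = norm2 mu (fun t => f t + rsum p t%:C%C)].
have S0 : has_inf S.
  split; first by exists (norm2 mu (fun t => f t + rsum [::] t%:C%C)), [::].
  by exists 0 => _ [p _ ->]; exact: norm2_ge0.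
have [_ [p gp ->] hp] := inf_adherent d0 S0.
have Sle p' : good eps 0 p' -> inf S <= norm2 mu (fun t => f t + rsum p' t%:C%C).
  by move=> gp'; apply: ge_inf; [case: S0|exists p'].
exists p; split => //.
  have pL := gL _ gp; have sL := L2D hf pL.
  have [_ i1] := (L2_integrable _ _).1 hf; have [_ i2] := (L2_integrable _ _).1 pL.
  have [_ i3] := (L2_integrable _ _).1 sL.
  (* The empty list is a competitor, so [f + rsum p] has energy at most [norm2 mu f + del]. *)
  have h0 : inf S <= norm2 mu f.
    have := Sle [::]; rewrite (_ : (fun t => f t + rsum [::] t%:C%C) = f); first by apply.
    by apply/funext => t; rewrite /rsum big_nil addr0.
  have h1 : norm2 mu (fun t => rsum p t%:C%C) <=
      2 * (norm2 mu (fun t => f t + rsum p t%:C%C) + norm2 mu f).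
    have i4 := EFin_integrableD i3 i1.
    rewrite -RintegralD // -RintegralZl //; apply: le_Rintegral => //.
      exact: EFin_integrableZ.
    move=> t _; rewrite -(cabs2N (f t)); apply: le_trans (cabs2D_le _ _).
    by rewrite addrAC subrr add0r.
  by lra.
move=> s c; rewrite lerBlDr; apply: le_trans (ltW hp) _; rewrite lerD2r.
pose q := (c, ((line s)^*)%C).
rewrite (_ : (fun t => _) = (fun t => f t + rsum (q :: p) t%:C%C)); last first.
  by apply/funext => t; rewrite /rsum big_cons /= [c / _ + _]addrC addrA.
apply: Sle => q'; rewrite inE => /orP[/eqP ->|/gp //].
by left; rewrite cImJ Im_line.
Qed.

Lemma T_epsE f s : T_eps mu eps f s = cintegral mu (fun t => f t / (line s - t%:C%C)).
Proof.
apply: eq_cintegral => t; congr (_ / _); rewrite addrAC; congr (_ + _ - _).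
by apply/eqP; rewrite eq_complex /=; apply/andP; split; apply/eqP; ring.
Qed.

(** Here [f] is split as [(f + rsum p) - rsum p]: the first part is nearly orthogonal to the
    kernels, and [gsum_bound] handles the second. The constants are [64 = 2 * 8 * 4],
    [32 = 2 * 8 * 2] and [6 = 2 * (1 + 2)]. *)
Lemma T_eps_bound f (del : R) : L2 mu f -> 0 < del ->
  exists psi : R -> R, [/\ mua.-integrable setT (EFin \o psi), (forall s, 0 <= psi s),
    Rintegral mua setT psi <= 64 / alpha ^+ 2 * norm2 mu f + 32 / alpha ^+ 2 * del &
    forall s, cabs2 (T_eps mu eps f s) <= psi s + 6 * E s * del].
Proof.
move=> hf d0; have [p [gp np hp]] := almost_minimizer hf d0.
have [phi [iphi phi0 ephi hphi]] := gsum_bound gp d0.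
have a2 : 0 < alpha ^+ 2 by rewrite exprn_even_gt0.
have pL : L2 mu (fun t => rsum p t%:C%C).
  exact: (rsum_L2 ki (admissible_Im (good_admissible eps0 gp))).
exists (fun s => 2 / alpha ^+ 2 * phi s); split.
- exact: EFin_integrableZ.
- by move=> s; rewrite mulr_ge0 // divr_ge0 // ltW.
- rewrite RintegralZl // -(ler_pM2l a2).
  have -> : alpha ^+ 2 * (2 / alpha ^+ 2 * Rintegral mua setT phi) = 2 * Rintegral mua setT phi.
    by field.
  have -> : alpha ^+ 2 * (64 / alpha ^+ 2 * norm2 mu f + 32 / alpha ^+ 2 * del) =
      64 * norm2 mu f + 32 * del by field.
  by lra.
- move=> s; rewrite T_epsE.
  have w0 : Im (line s) != 0 by rewrite Im_line.
  have w0' : Im ((line s)^*)%C != 0 by rewrite cImJ oppr_eq0.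
  have kL : L2 mu (fun t => (line s - t%:C%C)^-1).
    have -> : (fun t => (line s - t%:C%C)^-1) = (fun t => -1 * (t%:C%C - line s)^-1).
      by apply/funext => t; rewrite mulN1r -invrN opprB.
    by apply/L2Z/cauchy_L2 => //; exact: ki.
  have -> : cintegral mu (fun t => f t / (line s - t%:C%C)) =
      cintegral mu (fun t => (f t + rsum p t%:C%C) / (line s - t%:C%C)) +
      -1 * cintegral mu (fun t => rsum p t%:C%C / (line s - t%:C%C)).
    have i1 := L2M_cintegrable (L2D hf pL) kL; have i2 := L2M_cintegrable pL kL.
    rewrite -cintegralZ // -cintegralD //; last exact: cintegrableZ.
    by apply: eq_cintegral => t; rewrite mulN1r mulrDl addrK.
  have h1 := cauchy_pairing mu0 ki w0 (L2D hf pL) (hp s).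
  have h2 := hphi s.
  rewrite /gsum -cintegral_rsum_gsum // in h2; last 2 first.
    exact: admissible_Im (good_admissible eps0 gp).
    exact: good_neq_line gp.
  rewrite cabs2M cabs2_real in h2.
  apply: le_trans (cabs2D_le _ _) _; rewrite mulN1r cabs2N.
  rewrite -/(E s) in h1.
  move: h1 h2; set x := cabs2 _; set y := cabs2 _ => h1 h2.
  have h3 : y <= (phi s + 2 * alpha ^+ 2 * del * E s) / alpha ^+ 2.
    by rewrite ler_pdivlMr // mulrC.
  have e3 : (phi s + 2 * alpha ^+ 2 * del * E s) / alpha ^+ 2 =
      phi s / alpha ^+ 2 + 2 * del * E s by field.
  rewrite e3 in h3; rewrite mulrAC.
  by lra.
Qed.

Lemma T_eps_uniform f : L2 mu f ->
  (L2norm2 mua (T_eps mu eps f) <= (64 / alpha ^+ 2)%:E * L2norm2 mu f)%E.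
Proof.
move=> hf; rewrite (L2norm2E hf) -EFinM -/(norm2 mu f).
have a2 : 0 < alpha ^+ 2 by rewrite exprn_even_gt0.
have /choice[psi hpsi] : forall n : nat, exists psi : R -> R,
    [/\ mua.-integrable setT (EFin \o psi), (forall s, 0 <= psi s),
    Rintegral mua setT psi <= 64 / alpha ^+ 2 * norm2 mu f + 32 / alpha ^+ 2 * n.+1%:R^-1 &
    forall s, cabs2 (T_eps mu eps f s) <= psi s + 6 * E s * n.+1%:R^-1].
  by move=> n; apply: T_eps_bound.
(* With [del = 1 / (n + 1)] the error [6 * E s * del] vanishes at each [s], so the lower limit of
   [psi n] dominates [T_eps]; Fatou's lemma then bounds its integral. *)
apply: (@le_trans _ _ (\int[mua]_s limn_einf (fun n => (psi n s)%:E))%E).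
  apply: ge0_integral_mono => s; first by rewrite lee_fin cabs2_ge0.
  apply: (@limn_einf_ge _ _ _ (6 * E s)); first by rewrite mulr_ge0 // norm2_ge0.
  by move=> n; have [_ _ _ h] := hpsi n; rewrite lee_fin lerBlDr.
apply: le_trans (fatou mua measurableT _ _) _.
- by move=> n; have [h _ _ _] := hpsi n; exact: measurable_int h.
- by move=> n s _; have [_ h _ _] := hpsi n; rewrite lee_fin.
apply: (@limn_einf_le _ _ _ (32 / alpha ^+ 2)); first by rewrite divr_ge0 // ltW.
move=> n; have [h1 h2 h3 _] := hpsi n.
by rewrite -(fineK (integrable_fin_num _ h1)) // lee_fin.
Qed.


End UniformBound.

Unset Implicit Arguments.

Theorem theorem2p3 (R : realType) (mu : {measure set R -> \bar R})
  (mu_nz : mu setT != 0%E)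
  (mu_int : (\int[mu]_t ((1 + `|t|)^-1)%:E < +oo)%E)
  (alpha : R) (alpha_nz : alpha != 0)
  (mua : {measure set R -> \bar R}) (mua_def : is_mu_alpha mu alpha mua) :
  exists C : R, forall eps : R, eps != 0 ->
    forall f : R -> R[i], L2 mu f ->
      (L2norm2 mua (T_eps mu eps f) <= C%:E * L2norm2 mu f)%E.
Proof.
(* This bounds squared norms, so the operator norms are at most [8 / |alpha|]. *)
exists (64 / alpha ^+ 2) => eps eps0 f.
exact: (T_eps_uniform mu_nz alpha_nz (kernel_integrable_of_finite mu_int) mua_def eps0).
Qed.
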